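(* (p-validity of two-premise centering for conditional events.) Let $A,B,H,K$ be logically independent events. Then $\{A|H,\,B|K\}$ p-entails $(B|K)|(A|H)$. That is, $\{A|H,B|K\}$ is p-consistent (the assessment $(1,1)$ is coherent), and for every coherent assessment $(x,y,z,\mu)$ on $\{A|H,\ B|K,\ (A|H)\wedge(B|K),\ (B|K)|(A|H)\}$, if $x=P(A|H)=1$ and $y=P(B|K)=1$ then $\mu=\mathbb P[(B|K)|(A|H)]=1$.
   Context: Events are elements of a Boolean algebra with sure event $\Omega$ and impossible event $\emptyset$; $\overline{E}$ is negation, $EF$ is conjunction, and an event is identified with its $0/1$ indicator. Events $E_1,\dots,E_n$ are logically independent if all $2^n$ conjunctions of the $E_i$ or their negations are $\neq\emptyset$. The constituents generated by events are the nonimpossible such conjunctions. Given real values $x,y,z,\mu$: the conditional event $A|H$ is (numerically) the quantity $AH+x\overline H$, and $B|K$ is $BK+y\overline K$. The conjunction is the conditional random quantity $(A|H)\wedge(B|K)=\min\{AH+x\overline H,\,BK+y\overline K\}\,|\,(H\vee K)$, i.e. it equals that minimum if $H\vee K$ is true and equals its prevision $z$ if $\overline H\,\overline K$ is true. The iterated conditional is $(B|K)|(A|H)=(A|H)\wedge(B|K)+\mu\cdot(\overline A|H)$, where $\mu$ is its prevision and $\overline A|H=1-A|H=\overline AH+(1-x)\overline H$. Coherence (betting scheme). To the four objects $A|H$, $B|K$, $(A|H)\wedge(B|K)$, $(B|K)|(A|H)$ associate the gains $G_1=H(A-x)$, $G_2=K(B-y)$, $G_3=(A|H)\wedge(B|K)-z$,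 $G_4=(B|K)|(A|H)-\mu=(A|H)\wedge(B|K)-\mu\,(A|H)$, and the events on which the respective bets are not called off: $L_1=H$, $L_2=K$, $L_3=H\vee K$, and $L_4=$ the event that the quantity $A|H$ is nonzero, i.e. $L_4=AH$ if $x=0$ and $L_4=AH\vee\overline H$ if $x\neq0$. An assessment on the family (or on its first two members) is coherent if for every nonempty set $S$ of the corresponding indices and all real $s_i$ ($i\in S$), the set $D$ of values taken by $\sum_{i\in S}s_iG_i$ on the constituents (generated by $A,B,H,K$) contained in $\bigvee_{i\in S}L_i$ satisfies $\min D\le 0\le\max D$. p-consistency and p-entailment: a finite family of conditional random quantities with values in $[0,1]$ is p-consistent if assigning prevision $1$ to all members is coherent; a p-consistent family p-entails a further such quantity if in every coherent assessment in which all members of the family have prevision $1$ the further quantity has prevision $1$. Since the iterated conditional involves $z$, assessments are understood to include it. *)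

(* Defs.v *)
From mathcomp Require Import all_boot all_order all_algebra.
From mathcomp Require Import classical_sets reals.

Set Implicit Arguments.
Unset Strict Implicit.
Unset Printing Implicit Defensive.

Import Order.TTheory GRing.Theory Num.Theory.

Local Open Scope ring_scope.

(* Events are elements of an arbitrary Boolean algebra, i.e. of a complemented
   distributive lattice T with bottom (impossible) and top (sure). *)

Definition conjunct (d : Order.disp_t) (T : ctbDistrLatticeType d) (n : nat)
    (E : n.-tuple T) (w : {ffun 'I_n -> bool}) : T :=
  (\meet_(i < n) (if w i then tnth E i else ~` tnth E i))%O.

Definition logically_independent (d : Order.disp_t)
    (T : ctbDistrLatticeType d) (n : nat) (E : n.-tuple T) : Prop :=
  forall w : {ffun 'I_n -> bool}, conjunct E w != \bot%O.

Definition constituent (d : Order.disp_t) (T : ctbDistrLatticeType d)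
    (n : nat) (E : n.-tuple T) (c : T) : Prop :=
  (exists w : {ffun 'I_n -> bool}, c = conjunct E w) /\ c != \bot%O.

(* A random quantity is represented by its values on the constituents, hence as
   a function T -> R of which only the values at constituents matter. A
   constituent generated by E lies below exactly one of F, ~` F whenever the
   event F is generated by E, so that the following is then the value taken by
   the indicator of F on c. *)
Definition ind (d : Order.disp_t) (T : ctbDistrLatticeType d) (R : realType)
    (F c : T) : R := (c <= F)%O%:R.

(* An m-tuple of conditional objects. For an assessment P, gain P i c is the
   value on the constituent c of the gain of a unit bet on the i-th object, and
   active P i is the event on which that bet is not called off. The objects may
   themselves depend on the previsions. *)
Record family (d : Order.disp_t) (T : ctbDistrLatticeType d) (R : realType)
    (m : nat) := Family {
  gain : ('I_m -> R) -> 'I_m -> T -> R;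
  active : ('I_m -> R) -> 'I_m -> T
}.

Definition gain_values (d : Order.disp_t) (T : ctbDistrLatticeType d)
    (R : realType) (n m : nat) (E : n.-tuple T) (Q : family T R m)
    (P : 'I_m -> R) (S : {set 'I_m}) (s : 'I_m -> R) : set R :=
  [set v | exists c : T,
     [/\ constituent E c,
         (c <= \join_(i in S) active Q P i)%O &
         v = \sum_(i in S) s i * gain Q P i c]]%classic.

(* Coherence of P on the subfamily J; a and b are min D and max D. *)
Definition coherent_on (d : Order.disp_t) (T : ctbDistrLatticeType d)
    (R : realType) (n m : nat) (E : n.-tuple T) (Q : family T R m)
    (J : {set 'I_m}) (P : 'I_m -> R) : Prop :=
  forall S : {set 'I_m}, S \subset J -> S != finset.set0 ->
  forall s : 'I_m -> R,
  let D := gain_values E Q P S s in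
  exists a b : R,
    [/\ D a /\ lbound D a, D b /\ ubound D b & a <= 0 <= b].

(* Meant for a subfamily J whose objects do not involve the previsions of
   objects outside J; the values of P outside J are then irrelevant. *)
Definition p_consistent (d : Order.disp_t) (T : ctbDistrLatticeType d)
    (R : realType) (n m : nat) (E : n.-tuple T) (Q : family T R m)
    (J : {set 'I_m}) : Prop :=
  forall P : 'I_m -> R, (forall i, i \in J -> P i = 1) -> coherent_on E Q J P.

(* The assessments range over the whole family Q, which contains, besides the
   premises J and the conclusion j, any object whose prevision they involve. *)
Definition p_entails (d : Order.disp_t) (T : ctbDistrLatticeType d)
    (R : realType) (n m : nat) (E : n.-tuple T) (Q : family T R m)
    (J : {set 'I_m}) (j : 'I_m) : Prop :=
  p_consistent E Q J /\
  forall P : 'I_m -> R, coherent_on E Q [set: 'I_m] P ->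
    (forall i, i \in J -> P i = 1) -> P j = 1.

(* A|H with prevision x *)
Definition cond_event (d : Order.disp_t) (T : ctbDistrLatticeType d)
    (R : realType) (A H : T) (x : R) (c : T) : R :=
  ind R (A `&` H)%O c + x * ind R (~` H)%O c.

(* (A|H) /\ (B|K) with P(A|H) = x, P(B|K) = y and prevision z *)
Definition conjunction (d : Order.disp_t) (T : ctbDistrLatticeType d)
    (R : realType) (A H B K : T) (x y z : R) (c : T) : R :=
  if (c <= H `|` K)%O then Num.min (cond_event A H x c) (cond_event B K y c)
  else z.

(* (B|K)|(A|H) with prevision mu *)
Definition iterated (d : Order.disp_t) (T : ctbDistrLatticeType d)
    (R : realType) (A H B K : T) (x y z mu : R) (c : T) : R :=
  conjunction A H B K x y z c + mu * (1 - cond_event A H x c).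

Definition iA : 'I_4 := @Ordinal 4 0 isT.
Definition iB : 'I_4 := @Ordinal 4 1 isT.
Definition iConj : 'I_4 := @Ordinal 4 2 isT.
Definition iIter : 'I_4 := @Ordinal 4 3 isT.

(* The family A|H, B|K, (A|H) /\ (B|K), (B|K)|(A|H), with assessment
   (x, y, z, mu) = (P iA, P iB, P iConj, P iIter). *)
Definition iterated_gain (d : Order.disp_t) (T : ctbDistrLatticeType d)
    (R : realType) (A H B K : T) (P : 'I_4 -> R) (i : 'I_4) (c : T) : R :=
  let x := P iA in let y := P iB in let z := P iConj in let mu := P iIter in
  tnth [tuple ind R H c * (ind R A c - x);
              ind R K c * (ind R B c - y);
              conjunction A H B K x y z c - z;
              iterated A H B K x y z mu c - mu] i.

(* The last entry is the event that the quantity A|H is nonzero. *)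
Definition iterated_active (d : Order.disp_t) (T : ctbDistrLatticeType d)
    (R : realType) (A H B K : T) (P : 'I_4 -> R) (i : 'I_4) : T :=
  tnth [tuple H; K; (H `|` K)%O;
    (if P iA == 0 then A `&` H else (A `&` H) `|` ~` H)%O] i.

Definition iterated_family (d : Order.disp_t) (T : ctbDistrLatticeType d)
    (R : realType) (A H B K : T) : family T R 4 :=
  Family (iterated_gain A H B K) (iterated_active A H B K).

(* Main.v *)
Require Import Defs.
From mathcomp Require Import all_boot all_order all_algebra.
From mathcomp Require Import reals.
From mathcomp Require Import classical_sets ring lra.

(** The assessment [(1, 1)] is coherent because every bet on the premises has
    gain [0] on the constituent [A B H K].

    Suppose now [x = y = 1], and write [a], [b] for the values of [A|H], [B|K];
    they are 0 or 1, and [G1 = a - 1], [G2 = b - 1].  On [H \/ K] one has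
    [G3 = a b - z], so [G3 <= 1 - z] and [G3 - G1 - G2 >= 1 - z]; coherence
    gives [z = 1].  Then [G4 = a b - mu a] on every constituent.  If [mu < 1],
    [G4 - G1 - G2] is positive throughout; if [mu > 1], [G4 + G1] is negative
    throughout.  Hence [mu = 1]. *)

Set Implicit Arguments.
Unset Strict Implicit.
Unset Printing Implicit Defensive.

Import Order.Theory GRing.Theory Num.Theory.

Local Open Scope ring_scope.

Section Constituents.
Context (d : Order.disp_t) (T : ctbDistrLatticeType d) (n : nat).
Implicit Types (E : n.-tuple T) (c F G : T).

Lemma le_complN c F : c != \bot%O -> (c <= F)%O || (c <= ~` F)%O ->
  (c <= ~` F)%O = ~~ (c <= F)%O.
Proof.
move=> c0; case: (boolP (c <= F)%O) => //= cF _.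
apply/negbTE; apply: contra c0 => cF'.
by rewrite -lex0 -(meetxC F) lexI cF.
Qed.

(** Being below a join need not split in general. Here, if [c] lies below the complement of [F],
    meeting [F] away leaves only [G]. *)
Lemma le_join_decided c F G : (c <= F)%O || (c <= ~` F)%O ->
  (c <= F `|` G)%O = (c <= F)%O || (c <= G)%O.
Proof.
move=> cF; apply/idP/idP => [cFG|/orP[|] h]; last 2 first.
- exact: lexUl.
- exact: lexUr.
case/orP: cF => [->//|cF']; apply/orP; right.
have : (c <= (F `|` G) `&` ~` F)%O by rewrite lexI cFG.
by rewrite meetUl meetxC join0x => /le_trans; apply; exact: leIl.
Qed.

Lemma constituent_decides E c (i : 'I_n) : constituent E c ->
  (c <= tnth E i)%O || (c <= ~` tnth E i)%O.
Proof.
case=> [[w ->] _]; have : (conjunct E w <= if w i then tnth E i else ~` tnth E i)%O.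
  exact: meets_inf.
by case: (w i) => -> //; rewrite orbT.
Qed.

End Constituents.

Section Coherence.
Context (d : Order.disp_t) (T : ctbDistrLatticeType d) (R : realType).
Context (n m : nat) (E : n.-tuple T) (Q : Defs.family T R m).
Implicit Types (P s : 'I_m -> R) (S J : {set 'I_m}).

(** Constituents are indexed by the finitely many sign vectors [w], so a nonempty set of gains has a
    minimum and a maximum. *)
Lemma gain_values_attain P S s v : gain_values E Q P S s v ->
  exists a b : R,
    [/\ gain_values E Q P S s a /\ lbound (gain_values E Q P S s) a,
        gain_values E Q P S s b /\ ubound (gain_values E Q P S s) b &
        a <= v <= b].
Proof.
set D := gain_values E Q P S s.
pose ok (w : {ffun 'I_n -> bool}) := (conjunct E w != \bot%O) &&
  (conjunct E w <= \join_(i in S) active Q P i)%O.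
pose val w := \sum_(i in S) s i * gain Q P i (conjunct E w).
have DP u : D u <-> exists2 w, ok w & u = val w.
  split=> [[c [[[w ->] c0] cS ->]]|[w /andP[c0 cS] ->]].
    by exists w => //; rewrite /ok c0.
  by exists (conjunct E w); split=> //; split=> //; exists w.
move=> Dv; case/DP: (Dv) => w0 ok0 _.
have [lo oklo hlo] := arg_minP val ok0.
have [hi okhi hhi] := arg_maxP val ok0.
have Dlo : lbound D (val lo) by move=> u /DP[w okw ->]; exact: hlo.
have Dhi : ubound D (val hi) by move=> u /DP[w okw ->]; exact: hhi.
exists (val lo), (val hi); split.
- by split=> //; apply/DP; exists lo.
- by split=> //; apply/DP; exists hi.
- by rewrite Dlo //= Dhi.
Qed.

(** The form in which coherence gets exploited, together with its mirror image below: no bet has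
    gains of one strict sign on all active constituents. *)
Lemma coherent_on_le0 J P S s :
  coherent_on E Q J P -> S \subset J -> S != finset.set0 ->
  exists c, [/\ constituent E c, (c <= \join_(i in S) active Q P i)%O &
    \sum_(i in S) s i * gain Q P i c <= 0].
Proof.
move=> coh SJ S0; have [a [b [[[c [cE cS ->]] _] _ /andP[a0 _]]]] := coh S SJ S0 s.
by exists c.
Qed.

Lemma coherent_on_ge0 J P S s :
  coherent_on E Q J P -> S \subset J -> S != finset.set0 ->
  exists c, [/\ constituent E c, (c <= \join_(i in S) active Q P i)%O &
    0 <= \sum_(i in S) s i * gain Q P i c].
Proof.
move=> coh SJ S0; have [a [b [_ [[c [cE cS ->]] _] /andP[_ b0]]]] := coh S SJ S0 s.
by exists c.
Qed.

End Coherence.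

Section IteratedGain.
Context (d : Order.disp_t) (T : ctbDistrLatticeType d) (R : realType).
Context (A B H K c : T).
Hypothesis cE : constituent [tuple A; B; H; K] c.

(** At prevision 1 a called-off bet counts as won, so the conditional event takes the truth value of
    the material implication. *)
Let a := ~~ (c <= H)%O || (c <= A)%O.
Let b := ~~ (c <= K)%O || (c <= B)%O.

Lemma constituent_leNH : (c <= ~` H)%O = ~~ (c <= H)%O.
Proof.
by apply: le_complN; [case: cE | exact: (constituent_decides (@Ordinal 4 2 isT) cE)].
Qed.

Lemma constituent_leNK : (c <= ~` K)%O = ~~ (c <= K)%O.
Proof.
by apply: le_complN; [case: cE | exact: (constituent_decides (@Ordinal 4 3 isT) cE)].
Qed.

Lemma constituent_leHK : (c <= H `|` K)%O = (c <= H)%O || (c <= K)%O.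
Proof.
exact: le_join_decided (constituent_decides (@Ordinal 4 2 isT) cE).
Qed.

Lemma cond_event1A : cond_event A H 1 c = a%:R :> R.
Proof.
rewrite /cond_event /ind lexI constituent_leNH /a.
by case: (c <= H)%O; case: (c <= A)%O; rewrite /= ?mul1r ?add0r ?addr0.
Qed.

Lemma cond_event1B : cond_event B K 1 c = b%:R :> R.
Proof.
rewrite /cond_event /ind lexI constituent_leNK /b.
by case: (c <= K)%O; case: (c <= B)%O; rewrite /= ?mul1r ?add0r ?addr0.
Qed.

Lemma conjunction1 z : conjunction A H B K 1 1 z c =
  if (c <= H `|` K)%O then (a && b)%:R else z :> R.
Proof.
rewrite /conjunction cond_event1A cond_event1B.
by case: (c <= _)%O => //; case: a; case: b; rewrite ?minxx //=;
  [apply/min_idPr|apply/min_idPl].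
Qed.

(** Turns every total gain into arithmetic in the bits [a] and [b]. The first two terms need no
    factor for [H] or [K], because [a] is 1 off [H] and [b] is 1 off [K]. *)
Lemma iterated_gain_sum1 (P s : 'I_4 -> R) (S : {set 'I_4}) :
  P iA = 1 -> P iB = 1 ->
  \sum_(i in S) s i * iterated_gain A H B K P i c =
    (iA \in S)%:R * s iA * (a%:R - 1) +
    (iB \in S)%:R * s iB * (b%:R - 1) +
    (iConj \in S)%:R * s iConj *
      (conjunction A H B K 1 1 (P iConj) c - P iConj) +
    (iIter \in S)%:R * s iIter *
      (conjunction A H B K 1 1 (P iConj) c - P iIter * a%:R).
Proof.
move=> PA PB; rewrite big_mkcond !big_ord_recl big_ord0 /= addr0.
have -> : ord0 = iA by exact: val_inj.
have -> : lift iA ord0 = iB by exact: val_inj.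
have -> : lift iA (lift ord0 ord0) = iConj by exact: val_inj.
have -> : lift iA (lift ord0 (lift ord0 ord0)) = iIter by exact: val_inj.
rewrite /iterated_gain !(tnth_nth 0) /= PA PB /iterated cond_event1A.
have -> : ind R H c * (ind R A c - 1) = a%:R - 1.
  by rewrite /ind /a; case: (c <= H)%O; case: (c <= A)%O => /=; ring.
have -> : ind R K c * (ind R B c - 1) = b%:R - 1.
  by rewrite /ind /b; case: (c <= K)%O; case: (c <= B)%O => /=; ring.
by case: (iA \in S); case: (iB \in S); case: (iConj \in S);
  case: (iIter \in S) => /=; ring.
Qed.

End IteratedGain.

Section Centering.
Context (d : Order.disp_t) (T : ctbDistrLatticeType d) (R : realType).
Context (A B H K : T).
Let E := [tuple A; B; H; K].
Let Q := iterated_family R A H B K.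

Lemma premises_p_consistent :
  logically_independent E -> p_consistent E Q [set iA; iB].
Proof.
move=> hind P P1 S SJ S0 s.
have PA : P iA = 1 by apply: P1; rewrite !inE.
have PB : P iB = 1 by apply: P1; rewrite !inE.
pose c := conjunct E [ffun => true].
have cE : constituent E c by split; [exists [ffun => true] | exact: hind].
have cle i : (c <= tnth E i)%O.
  have : (c <= if [ffun => true] i then tnth E i else ~` tnth E i)%O.
    exact: meets_inf.
  by rewrite ffunE.
have := (cle (@Ordinal 4 0 isT), cle (@Ordinal 4 1 isT),
         cle (@Ordinal 4 2 isT), cle (@Ordinal 4 3 isT)).
rewrite !(tnth_nth \bot%O) /= => -[[[cA cB] cH] cK].
(* With [v] equal to 0, it suffices that 0 is among the gains; it is attained at [c]. *)
apply: gain_values_attain; exists c; split=> //.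
  have [i iS] := set0Pn _ S0; apply: (joins_min iS).
  by have := fintype.subsetP SJ i iS; rewrite !inE => /orP[]/eqP->;
    rewrite /= /iterated_active !(tnth_nth \bot%O).
rewrite (iterated_gain_sum1 cE) // cA cB !orbT.
have -> : (iConj \in S) = false.
  by apply/negP => /(fintype.subsetP SJ); rewrite !inE.
have -> : (iIter \in S) = false.
  by apply/negP => /(fintype.subsetP SJ); rewrite !inE.
by rewrite /=; ring.
Qed.

Lemma coherent_conj1 (P : 'I_4 -> R) : coherent_on E Q [set: 'I_4] P ->
  P iA = 1 -> P iB = 1 -> P iConj = 1.
Proof.
move=> coh PA PB; pose S : {set 'I_4} := [set iA; iB; iConj].
have S0 : S != finset.set0 by apply/set0Pn; exists iA; rewrite !inE.
(* Keeps [c] inside the event where the conjunction is the minimum and not its default value [z]. *)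
have actS c : (c <= \join_(i in S) active Q P i -> c <= H `|` K)%O.
  move=> /le_trans; apply; apply/joinsP => i.
  by rewrite !inE -orbA => /or3P[]/eqP->;
    rewrite /= /iterated_active !(tnth_nth \bot%O) /= ?leUl ?leUr.
apply/eqP; rewrite eq_le; apply/andP; split.
- have [c [cE /actS cS]] := coherent_on_ge0 (tnth [tuple 0; 0; 1; 0])
    coh (finset.subsetT S) S0.
  rewrite (iterated_gain_sum1 cE) // (conjunction1 cE) cS !inE /=.
  rewrite !(tnth_nth 0) /=.
  by case: (_ || _); case: (_ || _) => /=; lra.
(* The total gain is [(1 - a)(1 - b) + 1 - z], hence at least [1 - z]. *)
- have [c [cE /actS cS]] := coherent_on_le0 (tnth [tuple -1; -1; 1; 0])
    coh (finset.subsetT S) S0.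
  rewrite (iterated_gain_sum1 cE) // (conjunction1 cE) cS !inE /=.
  rewrite !(tnth_nth 0) /=.
  by case: (_ || _); case: (_ || _) => /=; lra.
Qed.

Lemma coherent_iter1 (P : 'I_4 -> R) : coherent_on E Q [set: 'I_4] P ->
  P iA = 1 -> P iB = 1 -> P iIter = 1.
Proof.
(* Off [H] and [K] both bits are 1, so [z = 1] makes the default value of the conjunction agree with
   the product [a b]. *)
move=> coh PA PB; have PC := coherent_conj1 coh PA PB.
have S0 : [set: 'I_4] != finset.set0 by apply/set0Pn; exists iA; rewrite !inE.
apply/eqP; rewrite eq_le; apply/andP; split; rewrite leNgt; apply/negP => mu1.
(* The bet on [A|H] contributes -1 when [a = 0], where the iterated conditional alone gains 0; when
   [a = 1] the total is [b - mu]. *)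
- have [c [cE _]] := coherent_on_ge0 (tnth [tuple 1; 0; 0; 1])
    coh (finset.subsetT _) S0.
  rewrite (iterated_gain_sum1 cE) // (conjunction1 cE) (constituent_leHK cE).
  rewrite PC !inE /= !(tnth_nth 0) /=.
  by case: (c <= A)%O; case: (c <= B)%O; case: (c <= H)%O; case: (c <= K)%O => /=; lra.
(* The total gain is [(1 - a)(1 - b) + 1 - mu a], positive for both values of [a] when [mu < 1]. *)
- have [c [cE _]] := coherent_on_le0 (tnth [tuple -1; -1; 0; 1])
    coh (finset.subsetT _) S0.
  rewrite (iterated_gain_sum1 cE) // (conjunction1 cE) (constituent_leHK cE).
  rewrite PC !inE /= !(tnth_nth 0) /=.
  by case: (c <= A)%O; case: (c <= B)%O; case: (c <= H)%O; case: (c <= K)%O => /=; lra.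
Qed.

End Centering.

Theorem mainTheorem9 (d : Order.disp_t) (T : ctbDistrLatticeType d)
    (R : realType) (A B H K : T)
    (hind : logically_independent [tuple A; B; H; K]) :
  p_entails [tuple A; B; H; K] (iterated_family R A H B K)
    [set iA; iB] iIter.
Proof.
split; first exact: premises_p_consistent.
by move=> P coh P1; apply: coherent_iter1 coh _ _; apply: P1; rewrite !inE.
Qed.
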